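(* Let $\Gamma$ be the first Grigorchuk group. Then $$\overline{L}(\Gamma)=R(\Gamma)=\overline{R}(\Gamma)=\{1\},$$ where $\overline{L}(\Gamma)$, $R(\Gamma)$ and $\overline{R}(\Gamma)$ denote respectively the sets of bounded left Engel elements, right Engel elements, and bounded right Engel elements of $\Gamma$.
   Context: Commutators and Engel elements. For elements $x,g$ of a group $G$, write $x^g=g^{-1}xg$, $[x,_1 g]=[x,g]=x^{-1}x^g$ and, for $n\geq 2$, $[x,_n g]=[[x,_{n-1} g],g]$. An element $g\in G$ is a bounded left Engel element if there is a positive integer $n=n(g)$ such that $[x,_n g]=1$ for all $x\in G$. It is a right Engel element if for every $x\in G$ there is a positive integer $n=n(g,x)$ such that $[g,_n x]=1$; it is a bounded right Engel element if $n$ can be chosen independently of $x$. The sets of bounded left Engel, right Engel and bounded right Engel elements of $G$ are denoted $\overline{L}(G)$, $R(G)$ and $\overline{R}(G)$ respectively. The first Grigorchuk group. Let $\mathcal{T}$ be the regular binary rooted tree with vertices indexed by $X^*$, the free monoid on the alphabet $X=\{0,1\}$ (the root is the empty word, and each word $w$ is joined to $w0$ and $w1$). An automorphism of $\mathcal{T}$ is a bijection of the vertices that preserves incidence; $\operatorname{Aut}\mathcal{T}$ is the group of all automorphisms. Let $\operatorname{st}(1)$ be the normal subgroup of $\operatorname{Aut}\mathcal{T}$ of automorphisms fixing all words of length $1$. For $g\in\operatorname{st}(1)$, the restrictions of $g$ to the subtrees hanging from the vertices $0$ and $1$ (each identified with $\mathcal{T}$) give automorphisms $g_1,g_2$ of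 $\mathcal{T}$, and $\psi:\operatorname{st}(1)\to\operatorname{Aut}\mathcal{T}\times\operatorname{Aut}\mathcal{T}$, $g\mapsto(g_1,g_2)$, is an injective homomorphism. Let $a$ be the rooted automorphism of $\mathcal{T}$ corresponding to the permutation $(0\,1)$ (it swaps the two subtrees hanging from $0$ and $1$, i.e. changes only the first letter of each nonempty word). Let $b,c,d\in\operatorname{st}(1)$ be defined recursively by $\psi(b)=(a,c)$, $\psi(c)=(a,d)$, $\psi(d)=(1,b)$. The first Grigorchuk group is $\Gamma=\langle a,b,c,d\rangle\leq\operatorname{Aut}\mathcal{T}$. *)

(* Defs.v *)
From HB Require Import structures.
From mathcomp Require Import all_boot.
From mathcomp Require Import boolp classical_sets.

Set Implicit Arguments.
Unset Strict Implicit.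
Unset Printing Implicit Defensive.

Local Open Scope classical_set_scope.
Local Open Scope group_scope.

(* In MathComp, x ^ y = y^-1 * (x * y) and [~ x, y] = x^-1 * x ^ y, which are
   the conventions x^g = g^-1 x g and [x, g] = x^-1 x^g used here. *)

Section Engel.
Variable G : groupType.
Implicit Types x g : G.

(* [x,_n g], extended by [x,_0 g] = x. *)
Definition engel_comm x n g : G := iter n (fun y => [~ y, g]) x.

Definition bounded_left_engel : set G :=
  [set g | exists n, (0 < n)%N /\ forall x, engel_comm x n g = 1].

Definition right_engel : set G :=
  [set g | forall x, exists n, (0 < n)%N /\ engel_comm g n x = 1].

Definition bounded_right_engel : set G :=
  [set g | exists n, (0 < n)%N /\ forall x, engel_comm g n x = 1].

End Engel.

Arguments bounded_left_engel : clear implicits.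
Arguments right_engel : clear implicits.
Arguments bounded_right_engel : clear implicits.

Section GeneratedSubgroup.
Variables (G : groupType) (S : set G).

Inductive generated : G -> Prop :=
| generated_incl g of S g : generated g
| generated1 : generated 1
| generatedM g h of generated g & generated h : generated (g * h)
| generatedV g of generated g : generated g^-1.

Definition generated_pred : {pred G} := fun g => `[< generated g >].

Lemma generated_predP g : reflect (generated g) (g \in generated_pred).
Proof. exact: asboolP. Qed.

Lemma generated_group_closed : group_closed generated_pred.
Proof.
split; first exact/generated_predP/generated1.
move=> g h /generated_predP Sg /generated_predP Sh.
by apply/generated_predP/generatedM => //; exact: generatedV.
Qed.

Definition generated_group := {g : G | g \in generated_pred}.

HB.instance Definition _ := SubChoice.on generated_group.
HB.instance Definition _ :=
  SubChoice_isSubGroup.Build G generated_pred generated_group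
    generated_group_closed.

End GeneratedSubgroup.

(* The letters 0 and 1 are encoded as false and true. *)
Definition vertex := seq bool.

Definition incident (u v : vertex) : Prop :=
  exists x : bool, v = rcons u x \/ u = rcons v x.

Record tree_aut := TreeAut {
  tree_fun :> vertex -> vertex;
  tree_inv : vertex -> vertex;
  tree_funK : cancel tree_fun tree_inv;
  tree_invK : cancel tree_inv tree_fun;
  tree_incident : forall u v,
    incident (tree_fun u) (tree_fun v) <-> incident u v
}.

Lemma tree_autP (g h : tree_aut) : g =1 h -> g = h.
Proof.
case: g h => [f i fK iK P] [f' i' fK' iK' P'] /= /funext eq_f.
move: fK iK P; rewrite eq_f {f eq_f} => fK iK P.
have /funext eq_i : i =1 i' by move=> v; apply: (can_inj fK'); rewrite iK iK'.
move: fK iK; rewrite eq_i => fK iK.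
by congr TreeAut; exact: Prop_irrelevance.
Qed.

Section TreeAutGroup.

Fact tree_one_subproof u v : incident (id u) (id v) <-> incident u v.
Proof. by []. Qed.

Definition tree_one : tree_aut :=
  @TreeAut id id (fun _ => erefl) (fun _ => erefl) tree_one_subproof.

Fact tree_inverse_subproof (g : tree_aut) u v :
  incident (tree_inv g u) (tree_inv g v) <-> incident u v.
Proof. by rewrite -(tree_incident g) !tree_invK. Qed.

Definition tree_inverse (g : tree_aut) : tree_aut :=
  TreeAut (@tree_invK g) (@tree_funK g) (@tree_inverse_subproof g).

Fact tree_mul_subproof (g h : tree_aut) u v :
  incident (h (g u)) (h (g v)) <-> incident u v.
Proof. by rewrite !tree_incident. Qed.

(* Automorphisms act on the right: g * h is g followed by h. *)
Definition tree_mul (g h : tree_aut) : tree_aut :=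
  @TreeAut (h \o g) (tree_inv g \o tree_inv h)
    (can_comp (@tree_funK h) (@tree_funK g))
    (can_comp (@tree_invK g) (@tree_invK h))
    (@tree_mul_subproof g h).

HB.instance Definition _ := gen_eqMixin tree_aut.
HB.instance Definition _ := gen_choiceMixin tree_aut.

Fact tree_mulA : associative tree_mul.
Proof. by move=> f g h; exact: tree_autP. Qed.
Fact tree_mul1 : left_id tree_one tree_mul.
Proof. by move=> g; exact: tree_autP. Qed.
Fact tree_mulr1 : right_id tree_one tree_mul.
Proof. by move=> g; exact: tree_autP. Qed.
Fact tree_mulV : left_inverse tree_one tree_inverse tree_mul.
Proof. by move=> g; apply: tree_autP => v /=; exact: tree_invK. Qed.
Fact tree_mulrV : right_inverse tree_one tree_inverse tree_mul.
Proof. by move=> g; apply: tree_autP => v /=; exact: tree_funK. Qed.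

HB.instance Definition _ := isGroup.Build tree_aut
  tree_mulA tree_mul1 tree_mulr1 tree_mulV tree_mulrV.

End TreeAutGroup.

(* The relation g \in st(1) and psi(g) = (g1, g2). *)
Definition psi_rel (g g1 g2 : tree_aut) : Prop :=
  (forall x : bool, g [:: x] = [:: x]) /\
  (forall w : vertex,
     g (false :: w) = false :: g1 w /\ g (true :: w) = true :: g2 w).

Section InvolutiveAut.
Variable f : vertex -> vertex.
Hypothesis f_invol : involutive f.
Hypothesis f_rcons : forall w x, exists y, f (rcons w x) = rcons (f w) y.

Lemma involutive_incident u v : incident (f u) (f v) <-> incident u v.
Proof.
have fI u' v' : incident u' v' -> incident (f u') (f v').
  case=> x [] ->.
    by case: (f_rcons u' x) => y ->; exists y; left.
  by case: (f_rcons v' x) => y ->; exists y; right.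
by split=> [/fI|/fI //]; rewrite !f_invol.
Qed.

Definition involutive_aut : tree_aut :=
  TreeAut f_invol f_invol involutive_incident.

End InvolutiveAut.

Definition grig_a_fun (w : vertex) : vertex :=
  if w is x :: w' then ~~ x :: w' else [::].

Fixpoint grig_b_fun (w : vertex) : vertex :=
  match w with
  | [::] => [::]
  | false :: w' => false :: grig_a_fun w'
  | true :: w' => true :: grig_c_fun w'
  end
with grig_c_fun (w : vertex) : vertex :=
  match w with
  | [::] => [::]
  | false :: w' => false :: grig_a_fun w'
  | true :: w' => true :: grig_d_fun w'
  end
with grig_d_fun (w : vertex) : vertex :=
  match w with
  | [::] => [::]
  | false :: w' => false :: w'
  | true :: w' => true :: grig_b_fun w'
  end.

Fact grig_a_invol : involutive grig_a_fun.
Proof. by case=> [|[] w]. Qed.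

Fact grig_a_rcons w x : exists y, grig_a_fun (rcons w x) = rcons (grig_a_fun w) y.
Proof. by case: w => [|x' w]; [exists (~~ x) | exists x]. Qed.

Fact grig_bcd_invol w :
  [/\ grig_b_fun (grig_b_fun w) = w, grig_c_fun (grig_c_fun w) = w
    & grig_d_fun (grig_d_fun w) = w].
Proof.
by elim: w => [|[] w [wb wc wd]] //=; split; rewrite ?grig_a_invol ?wb ?wc ?wd.
Qed.

Fact grig_bcd_rcons w x :
  [/\ exists y, grig_b_fun (rcons w x) = rcons (grig_b_fun w) y,
      exists y, grig_c_fun (rcons w x) = rcons (grig_c_fun w) y
    & exists y, grig_d_fun (rcons w x) = rcons (grig_d_fun w) y].
Proof.
elim: w => [|x' w [[yb wb] [yc wc] [yd wd]]]; first by case: x; split; eexists.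
have [ya wa] := grig_a_rcons w x.
case: x'; split=> /=; rewrite ?wa ?wb ?wc ?wd; by eexists.
Qed.

Definition grig_a : tree_aut := involutive_aut grig_a_invol grig_a_rcons.

Definition grig_b : tree_aut :=
  @involutive_aut grig_b_fun
    (fun w => let: And3 wb _ _ := grig_bcd_invol w in wb)
    (fun w x => let: And3 wb _ _ := grig_bcd_rcons w x in wb).

Definition grig_c : tree_aut :=
  @involutive_aut grig_c_fun
    (fun w => let: And3 _ wc _ := grig_bcd_invol w in wc)
    (fun w x => let: And3 _ wc _ := grig_bcd_rcons w x in wc).

Definition grig_d : tree_aut :=
  @involutive_aut grig_d_fun
    (fun w => let: And3 _ _ wd := grig_bcd_invol w in wd)
    (fun w x => let: And3 _ _ wd := grig_bcd_rcons w x in wd).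

Lemma psi_b : psi_rel grig_b grig_a grig_c.
Proof. by split=> [[]|w]. Qed.

Lemma psi_c : psi_rel grig_c grig_a grig_d.
Proof. by split=> [[]|w]. Qed.

Lemma psi_d : psi_rel grig_d 1 grig_b.
Proof. by split=> [[]|w]. Qed.

(* b, c and d are determined by the three recursive equations. *)
Lemma psi_bcd_unique (b c d : tree_aut) :
    psi_rel b grig_a c -> psi_rel c grig_a d -> psi_rel d 1 b ->
  [/\ b = grig_b, c = grig_c & d = grig_d].
Proof.
have root (g g1 g2 : tree_aut) : psi_rel g g1 g2 -> g [::] = [::].
  move=> [_ gE]; case Dw: (g [::]) => [//|[] w].
    have [_] := gE (tree_inv g2 w).
    by rewrite tree_invK -Dw => /(can_inj (@tree_funK g)).
  have [+ _] := gE (tree_inv g1 w).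
  by rewrite tree_invK -Dw => /(can_inj (@tree_funK g)).
move=> Pb Pc Pd.
have bcdE w : [/\ b w = grig_b w, c w = grig_c w & d w = grig_d w].
  elim: w => [|x w [wb wc wd]]; first by split; apply: root; eassumption.
  have [_ /(_ w)[b0 b1]] := Pb; have [_ /(_ w)[c0 c1]] := Pc.
  have [_ /(_ w)[d0 d1]] := Pd.
  by case: x; rewrite ?b0 ?b1 ?c0 ?c1 ?d0 ?d1 ?wb ?wc ?wd.
by split; apply: tree_autP => w; case: (bcdE w).
Qed.

Definition Grigorchuk : groupType :=
  generated_group [set grig_a; grig_b; grig_c; grig_d].

(* Main.v *)
Require Import Defs.
From HB Require Import structures.
From mathcomp Require Import all_boot.
From mathcomp Require Import boolp classical_sets.

(** Call an automorphism [k] plantable if, for each vertex [v], the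
    automorphism [plant v k] that acts as [k] below [v] and trivially elsewhere
    lies in the group.  The plantable elements form a normal subgroup, and it
    is large: it contains [(ab)^2], and there is a vertex at which each element
    of the group is the section of a plantable one ([plantable_lift]).  Two
    facts about the group are thereby transferred to plantable elements.

    - No exponent kills all of them ([plantable_unbounded_exponent]): the
      square of [(x, 1) a] is [(x, x)], so that orders can be doubled.
    - Some plantable [k] and [y] satisfy [[k,_n y] <> 1] for all [n]
      ([plantable_not_engel]).  The element [ad] permutes four vertices of
      level three cyclically without acting below them, and so commutation
      with [ad] acts on quadruples planted there by the map [F] that sends
      [(x0, x1, x2, x3)] to
      [(x0^-1 x1, x1^-1 x2, x2^-1 x3, x3^-1 x0)].  For [s = (ca, ab, 1, d)],
      the entries of [F^9 s] fix a vertex of level six, and their sections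
      there are the entries of [s] again ([shift_comm_cycle]).  Hence no
      [F^n s] is trivial.

    Right Engel elements.  If such an element fixes the first level, then its
    two sections are right Engel too, because each element of the group is a
    section of another one.  If it is [g = (g1, g2) a], then, for
    [z = (y, w)] with [w] the inverse of the conjugate of [k] by [g2^-1], the
    first section of [[g, z]] is [k y], and that of [[g,_(n+1) z]] is
    conjugate to [[k,_n y]] for [n > 0], which is not trivial.  By induction
    on the level, right Engel elements fix all vertices.

    Bounded left Engel elements.  Let [g <> 1] with [[x,_n g] = 1] for all [x].
    If some vertex has more than [n] distinct iterates under [g], then
    [[x,_n g]], for [x] planted there, still has a conjugate of [x] below the
    [n]-th iterate.  Otherwise choose a vertex [v] with the largest possible
    number [m > 1] of distinct iterates: then [g^m] is trivial below [v], so
    that the conjugates of [x = plant v k] by powers of [g] commute.  In that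
    abelian setting [[x,_n g] = 1] makes a power of [x], with an exponent that
    depends on [m] and [n] only, commute with [g], which moves [v]; so [k] has
    bounded exponent, a contradiction. *)

Set Implicit Arguments.
Unset Strict Implicit.
Unset Printing Implicit Defensive.

Local Open Scope classical_set_scope.
Local Open Scope group_scope.

(** * Iterated commutators *)
Lemma engel_commS (G : groupType) (x g : G) n :
  engel_comm x n.+1 g = [~ engel_comm x n g, g].
Proof. by []. Qed.

Lemma engel_comm1g (G : groupType) (g : G) n : engel_comm 1 n g = 1.
Proof. by elim: n => // n IHn; rewrite engel_commS IHn comm1g. Qed.

Lemma engel_commD (G : groupType) (x g : G) m n :
  engel_comm x (m + n) g = engel_comm (engel_comm x n g) m g.
Proof. exact: iterD. Qed.

Lemma engel_commJ (G : groupType) (x g z : G) n :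
  engel_comm x n g ^ z = engel_comm (x ^ z) n (g ^ z).
Proof. by elim: n => // n IHn; rewrite !engel_commS conjRg IHn. Qed.

Lemma gmulf_engel_comm (G H : groupType) (f : UMagmaMorphism.type G H) (x g : G) n :
  f (engel_comm x n g) = engel_comm (f x) n (f g).
Proof. by elim: n => // n IHn; rewrite !engel_commS gmulfR IHn. Qed.

(** The conjugates of [x] by powers of [g] generate an abelian group [A], in
    which [y |-> [y, g]] is an endomorphism.  If [y] is in [A] and the
    commutator [w = [y, g]] is [g]-invariant, then [y = y^(g^m) = y w^m], whence
    [w^m = 1].  So each factor [m] in the exponent of [x] saves one
    commutation. *)
Lemma engel_comm_invariant (G : groupType) (x g : G) m n :
    (forall i j, commute (x ^ (g ^+ i)) (x ^ (g ^+ j))) -> x ^ (g ^+ m) = x ->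
    engel_comm x n.+1 g = 1 ->
  (x ^+ (m ^ n)) ^ g = x ^+ (m ^ n).
Proof.
move=> xC xm.
pose A := generated [set x ^ (g ^+ i) | i in [set: nat]].
have Agen : A x by apply: generated_incl; exists 0; rewrite // conjg1.
have AJ y : A y -> A (y ^ g).
  elim=> [_ [i _ <-]||u v _ Au _ Av|u _ Au].
  - by apply: generated_incl; exists i.+1; rewrite // expgSr conjgM.
  - by rewrite conj1g; exact: generated1.
  - by rewrite conjMg; exact: generatedM.
  - by rewrite conjVg; exact: generatedV.
have AR y : A y -> A [~ y, g].
  by move=> Ay; apply: generatedM; [exact: generatedV | exact: AJ].
have AE k y : A y -> A (engel_comm y k g).
  by move=> Ay; elim: k => // k IHk; exact: AR.
have AX k y : A y -> A (y ^+ k).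
  move=> Ay; elim: k => [|k IHk]; first exact: generated1.
  by rewrite expgS; exact: generatedM.
have AC y z : A y -> A z -> commute y z.
  move=> Ay; elim=> [_ [j _ <-]||u v _ Cu _ Cv|u _ Cu]; first last.
  - exact: commuteV.
  - exact: commuteM.
  - exact: commute1.
  elim: Ay => [_ [i _ <-]||u v _ Cu _ Cv|u _ Cu].
  - exact: xC.
  - exact/commute_sym/commute1.
  - exact/commute_sym/commuteM/commute_sym.
  - exact/commute_sym/commuteV/commute_sym.
have Am y : A y -> y ^ (g ^+ m) = y.
  elim=> [_ [i _ <-]||u v _ uE _ vE|u _ uE].
  - by rewrite -conjgM -expgnDr addnC expgnDr conjgM xm.
  - exact: conj1g.
  - by rewrite conjMg uE vE.
  - by rewrite conjVg uE.
have EX k j y : A y -> engel_comm (y ^+ j) k g = engel_comm y k g ^+ j.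
  move=> Ay; elim: k => // k IHk; rewrite !engel_commS IHk !commgEl conjXg.
  rewrite -expVgn -expgMn //.
  by apply: AC; [apply: generatedV | apply: AJ]; exact: AE.
suff gen y : A y -> engel_comm y n.+1 g = 1 -> (y ^+ (m ^ n)) ^ g = y ^+ (m ^ n).
  exact: gen.
elim: n y => [|n IHn] y Ay Ey1.
  by rewrite expn0 expg1; apply/conjg_fixP/eqP.
rewrite expnS expgnA; apply: IHn; first exact: AX.
(* With y' the n-th commutator, w = [y', g] is g-invariant: so the conjugate of
   y' by g^j is y' w^j. *)
rewrite EX //; set w := engel_comm y n.+1 g.
have wg : w ^ g = w by apply/conjg_fixP/eqP.
have yj j : engel_comm y n g ^ (g ^+ j) = engel_comm y n g * w ^+ j.
  elim: j => [|j IHj]; first by rewrite expg0 conjg1 mulg1.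
  rewrite expgSr conjgM IHj conjMg conjXg wg expgS mulgA; congr (_ * _).
  by rewrite /w engel_commS commgEl mulVKg.
apply: (mulgI (engel_comm y n g)); rewrite -yj mulg1; apply: Am; exact: AE.
Qed.

(** * Automorphisms given by their two sections *)

Lemma mul_treeE (g h : tree_aut) u : (g * h) u = h (g u).
Proof. by []. Qed.

Lemma one_treeE u : (1 : tree_aut) u = u.
Proof. by []. Qed.

Lemma tree_mulVK (g : tree_aut) u : g^-1 (g u) = u.
Proof. exact: tree_funK. Qed.

Lemma tree_mulKV (g : tree_aut) u : g (g^-1 u) = u.
Proof. exact: tree_invK. Qed.

Lemma conj_treeE (g h : tree_aut) u : (g ^ h) (h u) = h (g u).
Proof. by rewrite conjgE !mul_treeE tree_mulVK. Qed.

Definition branch_fun (g h : vertex -> vertex) (u : vertex) : vertex :=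
  match u with
  | [::] => [::]
  | false :: u' => false :: g u'
  | true :: u' => true :: h u'
  end.

Lemma branch_funK g g' h h' :
  cancel g g' -> cancel h h' -> cancel (branch_fun g h) (branch_fun g' h').
Proof. by move=> gK hK [|[] u] //=; rewrite ?gK ?hK. Qed.

Lemma incident_root u : incident [::] u -> u \in [:: [:: false]; [:: true]].
Proof. by case=> x [->|]; [case: x | case: u => [|? []]]. Qed.

(** The root has two neighbours; any other vertex has three. *)
Lemma tree_root (g : tree_aut) : g [::] = [::].
Proof.
case Dg: (g [::]) => [//|x s]; exfalso; move: Dg; rewrite lastI.
set p := belast x s; set z := last x s; move=> gE.
pose nbrs := [:: p; rcons (rcons p z) false; rcons (rcons p z) true].
have nbrsP u : u \in nbrs -> incident (rcons p z) u.
  rewrite !inE => /or3P[] /eqP->.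
  - by exists z; right.
  - by exists false; left.
  - by exists true; left.
have /uniq_leq_size : uniq (map (tree_inv g) nbrs).
  rewrite (map_inj_uniq (can_inj (@tree_invK g))) /= !inE.
  have neq b : (p == rcons (rcons p z) b) = false.
    by apply/eqP => /(congr1 size); rewrite !size_rcons; elim: (size p) => // k IHk [].
  by rewrite !neq andbT /=; apply/eqP => /rcons_inj[].
move=> /(_ [:: [:: false]; [:: true]]) le3; suff: (3 <= 2)%N by [].
apply: le3 => _ /mapP[u /nbrsP nu ->]; apply: incident_root.
by rewrite -(tree_incident g) gE tree_invK.
Qed.

Lemma tree_root_eq (g : tree_aut) u : (g u == [::]) = (u == [::]).
Proof. by rewrite -{1}(tree_root g) (inj_eq (can_inj (@tree_funK g))). Qed.

Lemma incident_cons (x y : bool) u v :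
  incident (x :: u) (y :: v) <-> x = y /\ incident u v.
Proof.
split=> [[z]|[<- [z]]]; last first.
  by case=> ->; exists z; [left | right].
by case=> -[-> ->]; split=> //; exists z; [left | right].
Qed.

Lemma incident_rootE u : incident [::] u <-> exists x : bool, u = [:: x].
Proof.
by split=> [[x [->|]]|[x ->]]; [exists x | case: u => [|? []] | exists x; left].
Qed.

Lemma incident_sym u v : incident u v -> incident v u.
Proof. by case=> x [E|E]; exists x; [right | left]. Qed.

Section Pair.
Variable gh : tree_aut * tree_aut.
Let f := branch_fun gh.1 gh.2.

Fact pair_incident u v : incident (f u) (f v) <-> incident u v.
Proof.
have root1 (g : tree_aut) (x : bool) w :
    incident [::] (x :: g w) <-> incident [::] (x :: w).
  rewrite !incident_rootE; split=> -[y [-> /eqP]].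
    by rewrite tree_root_eq => /eqP->; exists y.
  by rewrite -(tree_root_eq g) => /eqP->; exists y.
have rootf w : incident [::] (f w) <-> incident [::] w.
  by case: w => [|[] w] //=; exact: root1.
case: u v => [|x u] v; first exact: rootf.
case: v => [|y v].
  split=> /incident_sym; last by move/(iffRL (rootf (x :: u)))/incident_sym.
  by move/(iffLR (rootf (x :: u)))/incident_sym.
by case: x y => -[] /=; rewrite !incident_cons ?tree_incident; split=> -[].
Qed.

(** The inverse of [psi]. *)
Definition pair_aut : tree_aut :=
  TreeAut (branch_funK (@tree_funK gh.1) (@tree_funK gh.2))
          (branch_funK (@tree_invK gh.1) (@tree_invK gh.2)) pair_incident.

End Pair.

Fact pair_aut_is_group_morphism :
  {morph pair_aut : x y / x * y^-1}.
Proof. by move=> [g1 g2] [h1 h2]; apply: tree_autP => -[|[] u]. Qed.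

HB.instance Definition _ := isGroupMorphism.Build
  (tree_aut * tree_aut)%type tree_aut pair_aut pair_aut_is_group_morphism.

Lemma pair_autJa g h : pair_aut (g, h) ^ grig_a = pair_aut (h, g).
Proof. by apply: tree_autP => -[|[] u]. Qed.

Lemma grig_bE : grig_b = pair_aut (grig_a, grig_c).
Proof. by apply: tree_autP => -[|[] u]. Qed.
Lemma grig_dE : grig_d = pair_aut (1, grig_b).
Proof. by apply: tree_autP => -[|[] u]. Qed.

(** * Sections *)

(** [g] maps the subtree at [v] onto the subtree at [v'], where it acts as [h]
    once both are identified with the whole tree. *)
Definition sect (v : vertex) (g : tree_aut) (v' : vertex) (h : tree_aut) :=
  forall u, g (v ++ u) = v' ++ h u.

Lemma sect1 v : sect v 1 v 1. Proof. by []. Qed.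

Lemma sectM v v' v'' g g' h h' :
  sect v g v' h -> sect v' g' v'' h' -> sect v (g * g') v'' (h * h').
Proof. by move=> gh gh' u; rewrite !mul_treeE gh gh'. Qed.

Lemma sectV v v' g h : sect v g v' h -> sect v' g^-1 v h^-1.
Proof. by move=> gh u; rewrite -{1}(tree_mulKV h u) -gh tree_mulVK. Qed.

Lemma sectJ v v' g z h y :
  sect v g v h -> sect v z v' y -> sect v' (g ^ z) v' (h ^ y).
Proof. by move=> gh zy; exact: sectM (sectV zy) (sectM gh zy). Qed.

Lemma sect_cat v v' w w' g h k :
  sect v g v' h -> sect w h w' k -> sect (v ++ w) g (v' ++ w') k.
Proof. by move=> gh hk u; rewrite -!catA gh hk. Qed.

Lemma sect_uniq v v' g h h' : sect v g v' h -> sect v g v' h' -> h = h'.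
Proof.
move=> gh gh'; apply: tree_autP => u.
by have /eqP := gh u; rewrite gh' eqseq_cat // eqxx => /eqP.
Qed.

Lemma sectX v g h n : sect v g v h -> sect v (g ^+ n) v (h ^+ n).
Proof.
by move=> gh; elim: n => // n IHn; rewrite !expgS; exact: sectM gh IHn.
Qed.

Lemma sect_eq1 v g : sect v 1 v g -> g = 1.
Proof. by move/(sect_uniq (@sect1 v)). Qed.

Lemma sect_engel_comm v x g y h n :
  sect v x v y -> sect v g v h -> sect v (engel_comm x n g) v (engel_comm y n h).
Proof.
move=> xy gh; elim: n => // n IHn; rewrite !engel_commS !commgEl.
by apply: sectM; [exact: sectV | exact: sectJ].
Qed.

Lemma sect_pair0 g h : sect [:: false] (pair_aut (g, h)) [:: false] g.
Proof. by []. Qed.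

(** * Automorphisms supported below one vertex *)

Definition plant (v : vertex) (g : tree_aut) : tree_aut :=
  foldr (fun x h => pair_aut (if x then (1, h) else (h, 1))) g v.

Fact plant_is_group_morphism v : {morph plant v : x y / x * y^-1}.
Proof.
elim: v => // x v IHv g h; rewrite /plant /= -!/(plant v _) IHv.
by case: x; rewrite -gmulfF; congr pair_aut; congr (_, _); rewrite mulgV.
Qed.

HB.instance Definition _ v := isGroupMorphism.Build
  tree_aut tree_aut (plant v) (plant_is_group_morphism v).

Lemma plant_cat v w g : plant (v ++ w) g = plant v (plant w g).
Proof. exact: foldr_cat. Qed.

Lemma sect_plant v g : sect v (plant v g) v g.
Proof. by elim: v => // -[] v IHv u /=; rewrite IHv. Qed.

Lemma plant_in v g u : plant v g (v ++ u) = v ++ g u.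
Proof. exact: sect_plant. Qed.

Lemma plant_out v g u : ~~ prefix v u -> plant v g u = u.
Proof.
elim: v u => [|x v IHv] [|y u] //=.
by case: x y => -[] //= /IHv ->.
Qed.

Lemma plantJ v v' g k h : sect v g v' h -> plant v k ^ g = plant v' (k ^ h).
Proof.
move=> gh; have gVh := sectV gh; apply: tree_autP => u.
rewrite conjgE !mul_treeE; case: (boolP (prefix v' u)) => [/prefixP[w ->]|v'u].
  by rewrite gVh !plant_in gh.
rewrite !plant_out ?tree_mulKV //; apply: contra v'u => /prefixP[w uE].
by rewrite -(tree_mulKV g u) uE gh prefix_prefix.
Qed.

Lemma plant_comm v w k h :
  size v = size w -> v != w -> commute (plant v k) (plant w h).
Proof.
move=> szvw vw; have out v1 w1 : size v1 = size w1 -> v1 != w1 ->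
    forall u, ~~ prefix v1 (w1 ++ u).
  move=> sz ne u; rewrite prefixE sz take_size_cat //; exact: contra_neq ne.
apply: tree_autP => u; rewrite !mul_treeE.
case: (boolP (prefix v u)) => [/prefixP[w' ->]|vu].
  by rewrite plant_in !(plant_out h) ?plant_in // out // eq_sym.
rewrite (plant_out _ vu); case: (boolP (prefix w u)) => [/prefixP[w' ->]|wu].
  by rewrite plant_in plant_out // out.
by rewrite !plant_out.
Qed.

(** * Words in the generators *)

Inductive letter := A | B | C | D.
Definition word := seq letter.

Definition letter_aut (l : letter) : tree_aut :=
  match l with A => grig_a | B => grig_b | C => grig_c | D => grig_d end.

Definition eval (w : word) : tree_aut := foldr (fun l g => letter_aut l * g) 1 w.

Lemma eval_cat w w' : eval (w ++ w') = eval w * eval w'.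
Proof. by elim: w => [|l w IHw] /=; rewrite ?mul1g // IHw mulgA. Qed.

Lemma letter_autV l : (letter_aut l)^-1 = letter_aut l.
Proof. by apply: tree_autP => u; case: l. Qed.

Lemma eval_rev w : eval (rev w) = (eval w)^-1.
Proof.
elim: w => [|l w IHw]; first by rewrite invg1.
by rewrite rev_cons -cats1 eval_cat IHw /= mulg1 invgM letter_autV.
Qed.

(** Reduction in the free product of [<a>] and the Klein group [{1, b, c, d}],
    which turns out to be a fine enough normal form for all the equalities of
    elements that are checked by computation below. *)
Definition cons_red (l : letter) (w : word) : word :=
  match l, w with
  | A, A :: w' | B, B :: w' | C, C :: w' | D, D :: w' => w'
  | B, C :: w' | C, B :: w' => D :: w'
  | C, D :: w' | D, C :: w' => B :: w'
  | D, B :: w' | B, D :: w' => C :: w'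
  | _, _ => l :: w
  end.

Definition reduce (w : word) : word := foldr cons_red [::] w.

Lemma grig_klein u :
  [/\ grig_c_fun (grig_b_fun u) = grig_d_fun u,
      grig_d_fun (grig_c_fun u) = grig_b_fun u
    & grig_b_fun (grig_d_fun u) = grig_c_fun u].
Proof.
elim: u => [|[] u [bc cd db]] //=; first by rewrite bc cd db.
by rewrite grig_a_invol.
Qed.

Lemma letter_klein :
  [/\ grig_b * grig_c = grig_d, grig_c * grig_d = grig_b
    & grig_d * grig_b = grig_c].
Proof.
by split; apply: tree_autP => u; rewrite mul_treeE /=; case: (grig_klein u).
Qed.

Lemma letter_aut2 l : letter_aut l * letter_aut l = 1.
Proof. by rewrite -{1}letter_autV mulVg. Qed.

Lemma eval_cons_red l w : eval (cons_red l w) = letter_aut l * eval w.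
Proof.
have [bc cd db] := letter_klein.
have inv2 k1 k2 k3 : letter_aut k1 * letter_aut k2 = letter_aut k3 ->
  letter_aut k2 * letter_aut k1 = letter_aut k3.
  by move=> /(congr1 (@inv _)); rewrite invgM !letter_autV.
have cb := inv2 B C D bc; have dc := inv2 C D B cd; have bd := inv2 D B C db.
have ll := (letter_aut2 A, letter_aut2 B, letter_aut2 C, letter_aut2 D).
by case: l; case: w => [|[] w] //=;
  rewrite mulgA ?(bc, cd, db, cb, dc, bd) ?ll ?mul1g.
Qed.

Lemma eval_reduce w : eval (reduce w) = eval w.
Proof. by elim: w => //= l w IHw; rewrite eval_cons_red IHw. Qed.

Definition letter_sec (x : bool) (l : letter) : word :=
  match l with
  | A => [::]
  | B => [:: if x then C else A]
  | C => [:: if x then D else A]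
  | D => if x then [:: B] else [::]
  end.

(** The section of the automorphism at the vertex [[:: x]], and the letter to
    which that vertex is sent. *)
Fixpoint word_sec (x : bool) (w : word) : word * bool :=
  if w is l :: w' then
    let: (s, y) := word_sec (if l is A then ~~ x else x) w' in
    (letter_sec x l ++ s, y)
  else ([::], x).

Lemma sect_letter x l :
  sect [:: x] (letter_aut l) [:: if l is A then ~~ x else x]
    (eval (letter_sec x l)).
Proof. by move=> u; case: x l => -[]. Qed.

Lemma sect_word x w :
  sect [:: x] (eval w) [:: (word_sec x w).2] (eval (word_sec x w).1).
Proof.
elim: w x => [|l w IHw] x //=; set x' := if l is A then _ else _.
case: word_sec (IHw x') => s y /= IH.
by rewrite eval_cat; apply: sectM IH; exact: sect_letter.
Qed.

(** The section at [v], provided that [v] is fixed. *)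
Fixpoint word_descend (v : vertex) (w : word) : option word :=
  if v is x :: v' then
    let: (s, y) := word_sec x w in
    if x == y then word_descend v' (reduce s) else None
  else Some (reduce w).

Lemma sect_descend v w w' :
  word_descend v w = Some w' -> sect v (eval w) v (eval w').
Proof.
elim: v w => [|x v IHv] w /=; first by case=> <-; rewrite eval_reduce.
case: word_sec (sect_word x w) => s y /= sxy; case: eqP => // <-{y} in sxy *.
move/IHv; rewrite eval_reduce; exact: (sect_cat sxy).
Qed.

(** * The Grigorchuk group and its sections *)

Notation grig := (generated [set grig_a; grig_b; grig_c; grig_d]).

Lemma grig_letter l : grig (letter_aut l).
Proof.
by apply: generated_incl; case: l => /=; [left; left; left | left; left; right
  | left; right | right].
Qed.

Lemma grigP g : grig g <-> exists w, g = eval w.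
Proof.
split=> [|[w ->{g}]]; last first.
  elim: w => [|l w IHw]; first exact: generated1.
  by apply: generatedM IHw; exact: grig_letter.
elim=> [h|| _ _ _ [w ->] _ [w' ->] | _ _ [w ->]].
- case=> [[[]|]|] ->; [exists [:: A] | exists [:: B] | exists [:: C] | exists [:: D]];
    by rewrite /= mulg1.
- by exists [::].
- by exists (w ++ w'); rewrite eval_cat.
- by exists (rev w); rewrite eval_rev.
Qed.

Lemma grig_eval w : grig (eval w). Proof. by apply/grigP; exists w. Qed.

Lemma grig_sect g v : grig g ->
  exists h, [/\ grig h, size (g v) = size v & sect v g (g v) h].
Proof.
elim: v g => [|x v IHv] g Gg; first by exists g; rewrite tree_root.
have [w ->] := (grigP g).1 Gg.
have [h [Gh sz hE]] := IHv _ (grig_eval (word_sec x w).1).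
by exists h; split=> //; have /= sx := sect_word x w; rewrite ?sx /= ?sz // => u;
  rewrite -cat1s -catA !cat1s (sx (v ++ u)) hE.
Qed.

Lemma grig_split g : grig g -> exists g1 g2, [/\ grig g1, grig g2 &
  g = pair_aut (g1, g2) \/ g = pair_aut (g1, g2) * grig_a].
Proof.
case/grigP=> w ->; exists (eval (word_sec false w).1), (eval (word_sec true w).1).
split; [exact: grig_eval | exact: grig_eval |].
have two : (word_sec true w).2 = ~~ (word_sec false w).2.
  suff two x : (word_sec (~~ x) w).2 = ~~ (word_sec x w).2 by exact: two false.
  elim: w x => //= -[] w IHw x.
  - by move: (IHw (~~ x)); case: word_sec => ? ?; case: word_sec.
  - by move: (IHw x); case: word_sec => ? ?; case: word_sec.
  - by move: (IHw x); case: word_sec => ? ?; case: word_sec.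
  - by move: (IHw x); case: word_sec => ? ?; case: word_sec.
have sf := sect_word false w; have st := sect_word true w; rewrite two {two} in st.
case: (word_sec false w).2 sf st => sf st; [right | left]; apply: tree_autP.
all: by case=> [|[] u]; rewrite ?tree_root //= ?[LHS]sf ?[LHS]st.
Qed.

(** The substitution [a -> aca, b -> d, c -> b, d -> c] has the identity as
    section at [[:: true]]. *)
Definition lift_letter (l : letter) : word :=
  match l with A => [:: A; C; A] | B => [:: D] | C => [:: B] | D => [:: C] end.

Lemma grig_lift1 x g : grig g -> exists2 h, grig h & sect [:: x] h [:: x] g.
Proof.
have lift w : sect [:: true] (eval (flatten (map lift_letter w))) [:: true] (eval w).
  elim: w => //= l w IHw; rewrite eval_cat; apply: sectM IHw => u.
  by case: l.
case/grigP=> w ->; case: x; first by exists (eval (flatten (map lift_letter w)));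
  [exact: grig_eval | exact: lift].
exists (eval (A :: flatten (map lift_letter w) ++ [:: A])); first exact: grig_eval.
by move=> u; rewrite /= eval_cat; exact: (congr1 grig_a (lift w u)).
Qed.

Lemma grig_lift v g : grig g -> exists2 h, grig h & sect v h v g.
Proof.
elim: v g => [|x v IHv] g; first by exists g.
by case/IHv=> h /(grig_lift1 x)[k Gk kh] hg; exists k => //; exact: (sect_cat kh hg).
Qed.

(** * Plantable elements *)

Record normal_in_grig (H : tree_aut -> Prop) : Prop := NormalInGrig {
  normal_sub : forall g, H g -> grig g;
  normal1 : H 1;
  normalM : forall g h, H g -> H h -> H (g * h);
  normalV : forall g, H g -> H g^-1;
  normalJ : forall g z, H g -> grig z -> H (g ^ z)
}.

Definition plantable (k : tree_aut) := forall v, grig (plant v k).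

Lemma grig_plantJ v k z : grig (plant v k) -> grig z -> grig (plant v (k ^ z)).
Proof.
move=> Gk /(grig_lift v)[z' Gz' /plantJ <-].
by apply: generatedM; [exact: generatedV | exact: generatedM].
Qed.

Lemma plantable_normal : normal_in_grig plantable.
Proof.
split=> [k /(_ [::]) //|v|k h Kk Kh v|k Kk v|k z Kk Gz v].
- by rewrite gmulf1; exact: generated1.
- by rewrite gmulfM; exact: generatedM (Kk v) (Kh v).
- by rewrite gmulfV; exact: generatedV (Kk v).
- exact: grig_plantJ (Kk v) Gz.
Qed.

Lemma plantable_plant v k : plantable k -> plantable (plant v k).
Proof. by move=> Kk u; rewrite -plant_cat. Qed.

(** Both sections are given in reduced form: so equality with an explicit pair
    of words is decided by computation. *)
Lemma word_pair w : (word_sec false w).2 = false -> (word_sec true w).2 = true ->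
  eval w = pair_aut (eval (reduce (word_sec false w).1),
                     eval (reduce (word_sec true w).1)).
Proof.
move=> e0 e1; have s0 := sect_word false w; have s1 := sect_word true w.
rewrite e0 in s0; rewrite e1 in s1; rewrite !eval_reduce.
by apply: tree_autP => -[|[] u]; [exact: tree_root | exact: s1 | exact: s0].
Qed.

Definition word_abab : word := [:: A; B; A; B].

(** With [t = (ab)^2 = (ca, ac)] and [d = (1, b)], the commutator [[t, d]] is
    [(1, [ac, b]) = (1, t^c)], and conjugation by [b = (a, c)] yields [(1, t)].
    So if [t] can be planted at [v], it can also be planted at both children
    of [v]. *)
Lemma plantable_abab : plantable (eval word_abab).
Proof.
apply: last_ind => [|v x IHv]; first exact: grig_eval.
rewrite -cats1 plant_cat.
have G1 : grig (plant v (plant [:: true] (eval word_abab))).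
  have -> : plant [:: true] (eval word_abab) = [~ eval word_abab, grig_d] ^ grig_b.
    have dE : grig_d = eval [:: D] by rewrite /= mulg1.
    have bE : grig_b = eval [:: B] by rewrite /= mulg1.
    rewrite commgEl !conjgE dE bE -!eval_rev -!eval_cat.
    by rewrite [RHS]word_pair.
  apply: grig_plantJ; last exact: grig_letter B.
  rewrite commgEl gmulfM; apply: generatedM; first by rewrite gmulfV; exact: generatedV.
  by apply: grig_plantJ; last exact: grig_letter D.
case: x => //; have -> : plant [:: false] (eval word_abab) =
  plant [:: true] (eval word_abab) ^ grig_a by rewrite /plant /= pair_autJa.
by apply: grig_plantJ; last exact: grig_letter A.
Qed.

(** * Each element is a section of a plantable one *)

Definition section0 (H : tree_aut -> Prop) (g : tree_aut) : Prop :=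
  exists2 k, H k & sect [:: false] k [:: false] g.

Lemma section0_normal H : normal_in_grig H -> normal_in_grig (section0 H).
Proof.
move=> nH; split=> [g [k Hk kg]||g h [k Hk kg] [l Hl lh]|g [k Hk kg]|g z [k Hk kg] Gz].
- have [h [Gh _]] := grig_sect [:: false] (normal_sub nH Hk).
  have -> : k [:: false] = [:: false] by rewrite (kg [::]) tree_root.
  by move/(sect_uniq kg) ->.
- by exists 1; [exact: normal1 | exact: sect1].
- by exists (k * l); [exact: normalM | exact: sectM kg lh].
- by exists k^-1; [exact: normalV | exact: sectV].
- have [z' Gz' zz'] := grig_lift1 false Gz.
  by exists (k ^ z'); [exact: normalJ | exact: sectJ].
Qed.

Lemma iter_section0 H n g : iter n section0 H g ->
  exists2 k, H k & sect (nseq n false) k (nseq n false) g.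
Proof.
elim: n g => [|n IHn] g /=; first by exists g.
case=> h /IHn[k Hk kh] hg; exists k => //.
have -> : false :: nseq n false = nseq n false ++ [:: false].
  by rewrite -(nseqD n 1) addn1.
exact: sect_cat kh hg.
Qed.

Lemma section0_word H w w' :
  H (eval w) -> word_descend [:: false] w = Some w' -> section0 H (eval w').
Proof. by move=> Hw /sect_descend; exists (eval w). Qed.

Lemma grig_sub_normal H : normal_in_grig H ->
  H grig_a -> H grig_c -> H grig_d -> forall g, grig g -> H g.
Proof.
move=> nH Ha Hc Hd g.
elim=> [_ [[[->|->]|->]|->] //||x y _ Hx _ Hy|x _ Hx].
- by have [_ <- _] := letter_klein; exact: normalM.
- exact: normal1.
- exact: normalM.
- exact: normalV.
Qed.

Definition lift_vertex : vertex := nseq 5 false.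

(** Let [H_i] be the set of sections of plantable elements at the [i]-th vertex
    of the leftmost ray: a normal subgroup.  From [abab] one gets in turn
    [ca] in [H_1], [ad] (from [caca]) in [H_2], [b] (from [adad]) in [H_3], [a]
    and [c] (from [b] and [aba]) in [H_4]; then [c], [aca] and [abab], the
    product of [a] and its conjugate by [b], give [a], [d] and [ca] in
    [H_5]. *)
Lemma plantable_lift g :
  grig g -> exists2 k, plantable k & sect lift_vertex k lift_vertex g.
Proof.
move=> Gg; apply: iter_section0; move: g Gg.
pose K i := iter i section0 plantable.
have nK i : normal_in_grig (K i).
  by elim: i => [|i IHi]; [exact: plantable_normal | exact: section0_normal].
have KM i w w' : K i (eval w) -> K i (eval w') -> K i (eval (w ++ w')).
  by rewrite eval_cat; apply: (normalM (nK i)).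
have KJ i w z : K i (eval w) -> K i (eval (rev z ++ w ++ z)).
  move=> Kw; rewrite !eval_cat eval_rev; exact: (normalJ (nK i)) Kw (grig_eval z).
have KD i w w' : K i (eval w) -> word_descend [:: false] w = Some w' ->
  K i.+1 (eval w') by exact: section0_word.
have K1 : K 1%N (eval [:: C; A]).
  exact: (KD 0%N word_abab [:: C; A] plantable_abab erefl).
have K2 : K 2%N (eval [:: A; D]).
  exact: (KD 1%N _ _ (KM 1%N _ _ K1 K1) erefl).
have K3 : K 3%N (eval [:: B]).
  exact: (KD 2%N _ _ (KM 2%N _ _ K2 K2) erefl).
have K4a : K 4%N (eval [:: A]) by exact: (KD 3%N _ _ K3 erefl).
have K4c : K 4%N (eval [:: C]) by exact: (KD 3%N _ _ (KJ 3%N _ [:: A] K3) erefl).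
have K5a : K 5%N (eval [:: A]) by exact: (KD 4%N _ _ K4c erefl).
have K5d : K 5%N (eval [:: D]) by exact: (KD 4%N _ _ (KJ 4%N _ [:: A] K4c) erefl).
have K5ca : K 5%N (eval [:: C; A]).
  exact: (KD 4%N _ _ (KM 4%N _ _ K4a (KJ 4%N _ [:: B] K4a)) erefl).
apply: (grig_sub_normal (nK 5%N)).
- by move: K5a; rewrite /= mulg1.
- by have := KM 5%N _ _ K5ca K5a; rewrite -eval_reduce /= mulg1.
- by move: K5d; rewrite /= mulg1.
Qed.

Lemma plantable_pair g h : plantable g -> plantable h -> plantable (pair_aut (g, h)).
Proof.
move=> Kg Kh; have -> : pair_aut (g, h) = plant [:: false] g * plant [:: true] h.
  by rewrite /plant /= -gmulfM; congr pair_aut; congr (_, _); rewrite (mulg1, mul1g).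
exact: (normalM plantable_normal) (plantable_plant _ Kg) (plantable_plant _ Kh).
Qed.

Lemma plantable1 : plantable 1. Proof. exact: normal1 plantable_normal. Qed.

Lemma grig_a_neq1 : grig_a <> 1.
Proof. by move/(congr1 (fun g : tree_aut => g [:: false])). Qed.

Lemma grig_a2 : grig_a * grig_a = 1.
Proof. exact: letter_aut2 A. Qed.

(** By induction on [p]: [a] for odd [p], and a lift of [(k, 1) a], whose square
    is [(k, k)], for [p = 2 q] and [k^q <> 1]. *)
Lemma plantable_unbounded_exponent p :
  (0 < p)%N -> exists2 k, plantable k & k ^+ p <> 1.
Proof.
elim/ltn_ind: p => p IHp p_gt0.
suff [g Gg gp] : exists2 g, grig g & g ^+ p <> 1.
  have [k Kk kg] := plantable_lift Gg; exists k => // kp.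
  by apply: gp; apply: (@sect_eq1 lift_vertex); rewrite -kp; exact: sectX.
have := odd_double_half p; case: (odd p) => pE.
  exists grig_a; first exact: (grig_letter A).
  rewrite -pE expgnDr -mul2n expgnA expg1 expg2 grig_a2 expg1n mulg1.
  exact: grig_a_neq1.
have q_gt0 : (0 < p./2)%N by move: p_gt0; rewrite -{1}pE double_gt0.
have [||k Kk kq] := IHp p./2 => //.
  by rewrite -{2}pE add0n -addnn -{1}[p./2]add0n ltn_add2r.
exists (pair_aut (k, 1) * grig_a).
  apply: generatedM (grig_letter A).
  exact: (plantable_pair Kk plantable1 [::]).
have sq : (pair_aut (k, 1) * grig_a) ^+ 2 = pair_aut (k, k).
  by apply: tree_autP => -[|[] u].
rewrite -pE add0n -mul2n expgnA sq => kk; apply: kq.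
apply: (@sect_eq1 [:: false]); rewrite -kk.
by apply: sectX.
Qed.

(** * A pair that satisfies no Engel identity *)

Definition quad (T : Type) : Type := (T * T * T * T)%type.

Definition rot4 T (x : quad T) : quad T :=
  let: (x0, x1, x2, x3) := x in (x1, x2, x3, x0).

Definition shift_comm (x : quad tree_aut) : quad tree_aut := x^-1 * rot4 x.

(** The entries sit at the vertices 000, 100, 001 and 101, in this order: [ad]
    maps each of these vertices to the previous one, so that conjugation by
    [ad] moves each entry one place down, which is [rot4]. *)
Definition quad_aut (x : quad tree_aut) : tree_aut :=
  let: (x0, x1, x2, x3) := x in
  pair_aut (pair_aut (pair_aut (x0, x2), 1), pair_aut (pair_aut (x1, x3), 1)).

Definition grig_ad : tree_aut := grig_a * grig_d.

Lemma pair_autJ x y z t : pair_aut (x, y) ^ pair_aut (z, t) = pair_aut (x ^ z, y ^ t).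
Proof. by rewrite -gmulfJ. Qed.

Lemma quad_autJ x : quad_aut x ^ grig_ad = quad_aut (rot4 x).
Proof.
case: x => [[[x0 x1] x2] x3]; rewrite /grig_ad conjgM pair_autJa grig_dE.
by rewrite grig_bE !pair_autJ conjg1 conj1g pair_autJa.
Qed.

Lemma quad_aut_comm x : [~ quad_aut x, grig_ad] = quad_aut (shift_comm x).
Proof.
rewrite commgEl quad_autJ; case: x => [[[x0 x1] x2] x3] /=.
rewrite -gmulfV -gmulfM; congr pair_aut; congr (_, _) => /=;
  rewrite -gmulfV -gmulfM; congr pair_aut; congr (_, _) => /=;
  by rewrite -?gmulfV -?gmulfM // mulVg.
Qed.

Lemma quad_aut_engel_comm x n :
  engel_comm (quad_aut x) n grig_ad = quad_aut (iter n shift_comm x).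
Proof. by elim: n => // n IHn; rewrite engel_commS IHn quad_aut_comm. Qed.

Lemma quad_aut_eq1 x : quad_aut x = 1 -> x = 1.
Proof.
case: x => [[[x0 x1] x2] x3] x1E.
have E (u : vertex) : quad_aut (x0, x1, x2, x3) u = u by rewrite x1E.
by congr (_, _, _, _); apply: tree_autP => u;
  [have := E [:: false, false, false & u] | have := E [:: true, false, false & u]
  |have := E [:: false, false, true & u] | have := E [:: true, false, true & u]];
  case.
Qed.

Definition quad_sect v (x y : quad tree_aut) : Prop :=
  let: (x0, x1, x2, x3) := x in let: (y0, y1, y2, y3) := y in
  [/\ sect v x0 v y0, sect v x1 v y1, sect v x2 v y2 & sect v x3 v y3].

Lemma quad_sect_shift_comm v x y n :
  quad_sect v x y -> quad_sect v (iter n shift_comm x) (iter n shift_comm y).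
Proof.
move=> xy; elim: n => //= n.
move: (iter n _ x) (iter n _ y) => [[[x0 x1] x2] x3] [[[y0 y1] y2] y3] [] *.
by split; apply: sectM => //; exact: sectV.
Qed.

Lemma quad_sect_eq1 v y : quad_sect v 1 y -> y = 1.
Proof.
by case: y => [[[y0 y1] y2] y3] [] /sect_eq1-> /sect_eq1-> /sect_eq1-> /sect_eq1->.
Qed.

Definition word_shift_comm (w : quad word) : quad word :=
  let: (w0, w1, w2, w3) := w in
  (reduce (rev w0 ++ w1), reduce (rev w1 ++ w2),
   reduce (rev w2 ++ w3), reduce (rev w3 ++ w0)).

Definition quad_eval (w : quad word) : quad tree_aut :=
  let: (w0, w1, w2, w3) := w in (eval w0, eval w1, eval w2, eval w3).

Lemma quad_eval_shift_comm w n :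
  quad_eval (iter n word_shift_comm w) = iter n shift_comm (quad_eval w).
Proof.
elim: n => //= n <-; move: (iter n _ w) => [[[w0 w1] w2] w3].
by rewrite /= !eval_reduce !eval_cat !eval_rev.
Qed.

(** Found by a search for cycles among quadruples under commutation and passage
    to sections. *)
Definition cycle_start : quad word := ([:: C; A], [:: A; B], [::], [:: D]).
Definition cycle_vertex : vertex := [:: false; false; false; false; true; false].

Lemma shift_comm_cycle :
  quad_sect cycle_vertex (iter 9 shift_comm (quad_eval cycle_start))
    (quad_eval cycle_start).
Proof.
rewrite -quad_eval_shift_comm.
have : let: (w0, w1, w2, w3) := iter 9 word_shift_comm cycle_start in
   [/\ word_descend cycle_vertex w0 = Some [:: C; A],
       word_descend cycle_vertex w1 = Some [:: A; B],
       word_descend cycle_vertex w2 = Some [::]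
     & word_descend cycle_vertex w3 = Some [:: D]] by vm_compute.
by move: (iter 9 _ _) => [[[w0 w1] w2] w3] [] /sect_descend ? /sect_descend ?
  /sect_descend ? /sect_descend ?.
Qed.

Lemma iter_shift_comm1 n : iter n shift_comm 1 = 1.
Proof. by elim: n => //= n ->; rewrite /shift_comm mulVg. Qed.

(** [F^n s] is a section of [F^(n+9) s]; so, if the iterates were ever to become
    trivial, then [s] would be trivial too. *)
Lemma iter_shift_comm_neq1 n : iter n shift_comm (quad_eval cycle_start) <> 1.
Proof.
elim/ltn_ind: n => n IHn sn1.
have [lt9n|le_n9] := leqP 9 n.
  apply: (IHn (n - 9)); first by rewrite ltn_subrL (leq_trans _ lt9n).
  apply: (@quad_sect_eq1 cycle_vertex); rewrite -sn1 -{1}(subnK lt9n) iterD.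
  exact: quad_sect_shift_comm shift_comm_cycle.
have s1 : quad_eval cycle_start = 1.
  apply: (@quad_sect_eq1 cycle_vertex); rewrite -(iter_shift_comm1 (9 - n)) -sn1.
  by rewrite -iterD subnK 1?ltnW //; exact: shift_comm_cycle.
by have /= := congr1 (fun x : quad tree_aut => x.2 [:: true; false; false]) s1.
Qed.

(** The quadruple of the cycle is first lifted to plantable elements, so that
    [quad_aut] of it lies in the group; then this element and [ad] are lifted
    in turn. *)
Lemma plantable_not_engel :
  exists k y, [/\ plantable k, plantable y & forall n, engel_comm k n y <> 1].
Proof.
have [k0 Kk0 kE0] := plantable_lift (grig_eval [:: C; A]).
have [k1 Kk1 kE1] := plantable_lift (grig_eval [:: A; B]).
have [k2 Kk2 kE2] := plantable_lift (grig_eval [::]).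
have [k3 Kk3 kE3] := plantable_lift (grig_eval [:: D]).
pose x : quad tree_aut := (k0, k1, k2, k3).
have Kx : plantable (quad_aut x).
  by do ![apply: plantable_pair => //]; exact: plantable1.
have Gad : grig grig_ad by exact: generatedM (grig_letter A) (grig_letter D).
have [y Ky yE] := plantable_lift Gad.
have [k Kk kE] := plantable_lift (Kx [::]).
exists k, y; split=> // n kn1; apply: (@iter_shift_comm_neq1 n).
have xs : quad_sect lift_vertex x (quad_eval cycle_start) by [].
apply: (@quad_sect_eq1 lift_vertex); have := quad_sect_shift_comm n xs.
rewrite (@quad_aut_eq1 (iter n shift_comm x)) // -quad_aut_engel_comm.
by apply: (@sect_eq1 lift_vertex); rewrite -kn1; exact: sect_engel_comm.
Qed.

(** * Right Engel elements *)

(** Since [[k y, y] = [k, y]^y]. *)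
Lemma engel_commMr (G : groupType) (k y : G) n :
  engel_comm (k * y) n.+1 y = engel_comm k n.+1 y ^ y.
Proof.
have yy : y ^ y = y by rewrite conjgE mulKg.
have kyR : engel_comm (k * y) 1 y = engel_comm k 1 y ^ y.
  rewrite !engel_commS /= commgEl conjMg yy invgM [RHS]conjgE commgEl.
  by rewrite !mulgA.
by rewrite -addn1 !engel_commD kyR [RHS]engel_commJ yy.
Qed.

Lemma right_engel_eq1 g : grig g ->
  (forall x, grig x -> exists n, engel_comm g n x = 1) -> g = 1.
Proof.
move=> Gg Rg; apply: tree_autP => u; rewrite one_treeE.
elim: u g Gg Rg => [|x u IHu] g Gg Rg; first exact: tree_root.
have [g0 [g1 [Gg0 Gg1 gE]]] := grig_split Gg.
have {}gE : g = pair_aut (g0, g1).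
  case: gE => // gE; exfalso.
  have [k [y [Kk Ky kyn]]] := plantable_not_engel.
  pose z := pair_aut (y, k^-1 ^ g1^-1).
  have Gz : grig z.
    apply: (plantable_pair Ky _ [::]).
    apply: (normalJ plantable_normal); last exact: generatedV.
    exact: (normalV plantable_normal).
  (* Two further commutations: one turns g into k y at the first vertex, the
     other turns k y into a conjugate of [k, y]. *)
  have [n gn1] := Rg z Gz; apply: (kyn n.+1); apply/eqP.
  rewrite -(conjg_eq1 _ y) -engel_commMr; apply/eqP.
  apply: (@sect_eq1 [:: false]); rewrite -(engel_comm1g z 2) -gn1 -engel_commD.
  rewrite add2n -addn1 engel_commD; apply: sect_engel_comm; last exact: sect_pair0.
  have -> : engel_comm g 1 z = (z ^ g)^-1 * z.
    by rewrite /engel_comm /= commgEr conjVg.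
  rewrite gE conjgM pair_autJ pair_autJa conjgKV -gmulfV -gmulfM.
  by rewrite -{2}(invgK k); exact: sect_pair0.
have gx : sect [:: x] g [:: x] (if x then g1 else g0) by rewrite gE; case: x.
rewrite (gx u) IHu //; first by case: (x).
move=> y /(grig_lift1 x)[z /Rg[n gn1] zy]; exists n.
by apply: (@sect_eq1 [:: x]); rewrite -gn1; exact: sect_engel_comm.
Qed.

(** * Bounded left Engel elements *)

Lemma grigX g j : grig g -> grig (g ^+ j).
Proof.
move=> Gg; elim: j => [|j IHj]; first exact: generated1.
by rewrite expgS; exact: generatedM.
Qed.

Lemma plant_conjX g v k j : grig g -> exists h, [/\ grig h,
  size ((g ^+ j) v) = size v & plant v k ^ (g ^+ j) = plant ((g ^+ j) v) (k ^ h)].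
Proof.
move=> Gg; have [h [Gh sz gh]] := grig_sect v (grigX j Gg).
by exists h; split=> //; exact: plantJ.
Qed.

(** Only the return to [v] is excluded, but, [g] being a bijection, this makes
    the first [m] iterates of [v] pairwise distinct. *)
Definition distinct_iterates (g : tree_aut) (m : nat) (v : vertex) : Prop :=
  forall j, (0 < j < m)%N -> (g ^+ j) v <> v.

Lemma distinct_iterates_neq g v m i j : distinct_iterates g m v -> (i < j < m)%N ->
  (g ^+ i) v != (g ^+ j) v.
Proof.
move=> fv /andP[ltij ltjm]; apply/eqP => eqv; apply: (fv (j - i)).
  by rewrite subn_gt0 ltij (leq_ltn_trans (leq_subr i j)).
by rewrite expgnFr 1?ltnW // mul_treeE -eqv tree_mulVK.
Qed.

(** Below the vertices that are reached after [i] steps or later, the [i]-th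
    commutator acts as the conjugate of [plant v k] by [g^i] alone. *)
Lemma engel_comm_distinct_iterates g v n k : grig g -> distinct_iterates g n.+1 v ->
  engel_comm (plant v k) n g = 1 -> k = 1.
Proof.
move=> Gg fv yn1; set x := plant v k in yn1.
suff agree i : (i <= n)%N -> forall j u, (i <= j <= n)%N ->
    engel_comm x i g ((g ^+ j) v ++ u) = (x ^ (g ^+ i)) ((g ^+ j) v ++ u).
  have [h [_ _ xE]] := plant_conjX v k n Gg.
  apply/eqP; rewrite -(conjg_eq1 _ h); apply/eqP.
  apply: (@sect_eq1 ((g ^+ n) v)) => u.
  by rewrite -yn1 agree ?leqnn // xE plant_in.
elim: i => [|i IHi] le_in j u le_ij; first by rewrite expg0 conjg1.
case: j le_ij => // j /andP[le_ij lt_jn].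
have xfix : (x ^ (g ^+ i)) ((g ^+ j.+1) v ++ u) = (g ^+ j.+1) v ++ u.
  have [h [_ szi ->]] := plant_conjX v k i Gg.
  have [_ [_ szj _]] := plant_conjX v k j.+1 Gg.
  rewrite plant_out // prefixE szi -szj take_size_cat // eq_sym.
  by apply: (@distinct_iterates_neq g v n.+1) => //; rewrite le_ij ltnS.
have [h [_ _ gVh]] := grig_sect ((g ^+ j.+1) v) (generatedV Gg).
have gVE : g^-1 ((g ^+ j.+1) v) = (g ^+ j) v by rewrite expgSr mul_treeE tree_mulVK.
rewrite gVE in gVh; rewrite engel_commS commgEl mul_treeE.
have -> : (engel_comm x i g)^-1 ((g ^+ j.+1) v ++ u) = (g ^+ j.+1) v ++ u.
  by rewrite -{1}xfix -IHi ?tree_mulVK ?(ltnW le_in) // (ltnW le_ij).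
have -> : x ^ (g ^+ i.+1) = (x ^ (g ^+ i)) ^ g by rewrite expgSr conjgM.
rewrite -(tree_mulKV g (_ ++ u)) gVh !conj_treeE IHi ?(ltnW le_in) //.
by rewrite -ltnS le_ij ltnW.
Qed.

(** [x = plant v k] commutes with [g^m], and its conjugates by [g^i] and [g^j]
    have disjoint supports unless [i = j] modulo [m], when they are equal:
    so [engel_comm_invariant] applies.  A power of [x] that commutes with [g],
    which moves [v], is trivial. *)
Lemma engel_comm_exact_orbit g v n m k :
  grig g -> distinct_iterates g m v -> (1 < m)%N ->
  (forall u, (g ^+ m) (v ++ u) = v ++ u) ->
  engel_comm (plant v k) n.+1 g = 1 -> k ^+ (m ^ n) = 1.
Proof.
move=> Gg fv m_gt1 gm; set x := plant v k => xn1.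
have m_gt0 := ltnW m_gt1.
have xm : x ^ (g ^+ m) = x.
  by rewrite /x -{2}[k]conjg1; apply: plantJ.
have xC i j : commute (x ^ (g ^+ i)) (x ^ (g ^+ j)).
  wlog le_ij : i j / (i <= j)%N.
    by move=> C; case/orP: (leq_total i j) => /C //; exact: commute_sym.
  have xmX q : x ^ (g ^+ (q * m)) = x.
    by elim: q => [|q IHq]; rewrite ?expg0 ?conjg1 // mulSn expgnDr conjgM xm IHq.
  rewrite -(subnK le_ij) expgnDr conjgM /commute -!conjMg; congr (_ ^ _).
  rewrite (divn_eq (j - i) m) expgnDr conjgM xmX.
  have [h [_ sz xrE]] := plant_conjX v k ((j - i) %% m) Gg.
  have [->|r_gt0] := posnP ((j - i) %% m); first by rewrite expg0 conjg1.
  rewrite xrE; apply: plant_comm => //; rewrite eq_sym; apply/eqP/fv.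
  by rewrite r_gt0 ltn_pmod.
have := engel_comm_invariant xC xm xn1; rewrite -gmulfXn.
have [h [_ sz]] := plant_conjX v (k ^+ (m ^ n)) 1 Gg; rewrite expg1 => -> gE.
apply: (@sect_eq1 v) => u; rewrite one_treeE -plant_in -gE plant_out //.
rewrite prefixE (sz : size (g v) = _) take_size_cat // eq_sym; apply/eqP.
exact: (fv 1%N).
Qed.

(** Being maximal, [m] is such that no vertex has [m + 1] distinct iterates; this
    applies to [v] and to all the vertices below it, and makes [g^m] trivial
    there. *)
Lemma bounded_left_engel_eq1 g n : grig g ->
  (forall x, grig x -> engel_comm x n.+1 g = 1) -> g = 1.
Proof.
move=> Gg gn; apply: contrapT => g_neq1.
have [v2 fv2] : exists v, distinct_iterates g 2 v.
  apply: contrapT => fix_all; apply: g_neq1; apply: tree_autP => v.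
  apply: contrapT => gv; apply: fix_all; exists v => -[|[|//]] // _.
have [k Kk k_neq1] : exists2 k, plantable k & k <> 1.
  by have [k Kk] := @plantable_unbounded_exponent 1 isT; exists k.
have no_big v : ~ distinct_iterates g n.+2 v.
  by move=> fv; apply: k_neq1; apply: engel_comm_distinct_iterates fv (gn _ (Kk v)).
have [m [v [m_gt1 fv max]]] : exists m v,
    [/\ (1 < m)%N, distinct_iterates g m v & forall u, ~ distinct_iterates g m.+1 u].
  have: forall u, ~ distinct_iterates g (2 + n) u by [].
  elim: (n) => [|j IHj] no_j; first by case: (no_j v2).
  have [[v fv]|] := pselect (exists v, distinct_iterates g (2 + j) v).
    by exists (2 + j), v; split=> // u; rewrite -addnS.
  by move=> no; apply: IHj => u fu; apply: no; exists u.
have gm u : (g ^+ m) (v ++ u) = v ++ u.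
  apply: contrapT => moved; apply: (max (v ++ u)) => j /andP[j_gt0].
  rewrite ltnS leq_eqVlt => /orP[/eqP-> //|ltjm] fixed; apply: (fv j).
    by rewrite j_gt0.
  have [h [_ sz gh]] := grig_sect v (grigX j Gg).
  by move/eqP: fixed; rewrite gh eqseq_cat // => /andP[/eqP].
have [|l Kl] := @plantable_unbounded_exponent (m ^ n); first by rewrite expn_gt0 ltnW.
apply; apply: (engel_comm_exact_orbit Gg fv m_gt1 gm); exact: gn (Kl v).
Qed.

(** * Engel elements of the Grigorchuk group *)

Lemma val_engel_comm (x g : Grigorchuk) n :
  val (engel_comm x n g) = engel_comm (val x) n (val g).
Proof. exact: gmulf_engel_comm. Qed.

Lemma val_grig (g : Grigorchuk) : grig (val g).
Proof. exact/generated_predP/valP. Qed.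

Lemma grig_val g : grig g -> exists x : Grigorchuk, val x = g.
Proof.
move=> /generated_predP Gg; by exists (Sub g Gg); rewrite SubK.
Qed.

Theorem theorem1p2 :
  [/\ bounded_left_engel Grigorchuk = right_engel Grigorchuk,
      right_engel Grigorchuk = bounded_right_engel Grigorchuk
    & bounded_right_engel Grigorchuk = [set 1%g] ].
Proof.
have L1 : bounded_left_engel Grigorchuk = [set 1].
  apply/seteqP; split=> [g [[|n] [n_gt0 gn]]|_ ->] //=.
    apply: val_inj; apply: (@bounded_left_engel_eq1 _ n) (val_grig g) _.
    by move=> _ /grig_val[x <-]; rewrite -val_engel_comm gn val1.
  by exists 1%N; split=> // x; rewrite /engel_comm /= commg1.
have R1 : right_engel Grigorchuk = [set 1].
  apply/seteqP; split=> [g Rg|_ -> x] /=.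
    apply: val_inj; apply: right_engel_eq1 (val_grig g) _.
    move=> _ /grig_val[x <-]; have [n [_ gn]] := Rg x.
    by exists n; rewrite -val_engel_comm gn val1.
  by exists 1%N; rewrite engel_comm1g.
have BR1 : bounded_right_engel Grigorchuk = [set 1].
  apply/seteqP; split=> [g [n [n_gt0 gn]]|_ ->] /=.
    by rewrite -[_ = _]/([set 1] g) -R1 => x; exists n.
  by exists 1%N; split=> // x; rewrite engel_comm1g.
by rewrite L1 R1 BR1.
Qed.
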